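(* Under hypotheses (H1), (H2), (H3) of the context, the fully discrete scheme (F) of the context preserves the energy $$E^k=\int_\Omega\tfrac12\varrho_h^k|\boldsymbol u_h^k|^2+\varrho_h^k\,e(\varrho_h^k,\varsigma_h^k)+\tfrac12|\beta_h^k|^2,\qquad|\beta|^2:=\beta\wedge\star\beta,$$ i.e. $E^{k+1}=E^k$ for every solution of (F).
   Context: Setting. $\Omega\subset\mathbb{R}^n$ ($n=2,3$) is a domain with boundary $\partial\Omega$ regular enough for Stokes' theorem; $X(\Omega)$ is the set of vector fields on $\Omega$ tangent to $\partial\Omega$. $d$ is the exterior derivative, $\star$ the Hodge operator, $i_{\boldsymbol u}$ the interior product with a vector field $\boldsymbol u$. $e=e(\rho,s)$ is a given smooth function (internal energy). An $n$-form $\varrho=\rho\,dV$ is identified with its scalar density $\rho$ whenever it is an argument of $e$, appears in a quotient, or multiplies another $n$-form or a vector field inside an integrand; e.g. $\int_\Omega(\varrho\boldsymbol u)\cdot\boldsymbol v=\int_\Omega\rho\,\boldsymbol u\cdot\boldsymbol v\,dV$. (H1) $V_h^0,\dots,V_h^n$ are finite-dimensional spaces, $V_h^i$ consisting of $i$-forms on $\Omega$ on which $d$ is well defined, with $d(V_h^i)\subset V_h^{i+1}$. (H2) There are linear projection operators $\Pi^i$ onto $V_h^i$, $0\le i\le n$ (with domain containing all the forms to which they are applied below), which preserve the vanishing of forms at the boundary: if $\alpha$ has vanishing trace (pullback) on $\partial\Omega$, so does $\Pi^i\alpha$. $X_h\subset X(\Omega)$ is a finite-dimensional vector space of discrete vector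 fields. Let $$\mathfrak g_h=\{(A^0,\dots,A^n)\in L(V_h^0)\times\cdots\times L(V_h^n):\ dA^{i-1}=A^i d\},$$ with $L(V)$ the linear endomorphisms of $V$, and bracket $[A,B]^i=A^iB^i-B^iA^i$. For $\boldsymbol u_h\in X_h$, $A_{\boldsymbol u_h}=(A^0_{\boldsymbol u_h},\dots,A^n_{\boldsymbol u_h})\in\mathfrak g_h$ is defined by $$A^i_{\boldsymbol u_h}\alpha_h=d\,\Pi^{i-1}(i_{\boldsymbol u_h}\alpha_h)+\Pi^i(i_{\boldsymbol u_h}d\alpha_h),\qquad \alpha_h\in V_h^i,$$ (the first term is $0$ for $i=0$, the second is $0$ for $i=n$). (H3) The map $\boldsymbol u_h\mapsto A_{\boldsymbol u_h}$ from $X_h$ to $\mathfrak g_h$ is injective and a linear left inverse $\hat{\cdot}:\mathfrak g_h\to X_h$ is fixed: $\widehat{A_{\boldsymbol u_h}}=\boldsymbol u_h$ for all $\boldsymbol u_h\in X_h$. Fully discrete scheme (F). The time step $\Delta t$ is constant; $a^k$ is the value of a variable at time $k\Delta t$ and $a^{k+\frac12}=\frac{a^{k+1}+a^k}{2}$. Given $(\boldsymbol u_h^k,\varrho_h^k,\varsigma_h^k,\beta_h^k)\in X_h\times V_h^n\times V_h^n\times V_h^{n-1}$, the next state $(\boldsymbol u_h^{k+1},\varrho_h^{k+1},\varsigma_h^{k+1},\beta_h^{k+1})$ in the same space satisfies, writing $F^{a,b}=\varrho_h^{a}\,e(\varrho_h^{a},\varsigma_h^{b})$ for $a,b\in\{k,k+1\}$,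 for all $\boldsymbol v_h\in X_h$: $$ \begin{aligned} &\int_\Omega\frac{\varrho_h^{k+1}\boldsymbol u_h^{k+1}-\varrho_h^k\boldsymbol u_h^k}{\Delta t}\cdot\boldsymbol v_h-\varrho_h^{k+\frac12}\boldsymbol u_h^{k+\frac12}\cdot\widehat{[A_{\boldsymbol v_h},A_{\boldsymbol u_h^{k+\frac12}}]}\\ &\quad+\Big(\frac{\boldsymbol u_h^k\cdot\boldsymbol u_h^{k+1}}{2}-\frac12\Big(\frac{F^{k+1,k+1}-F^{k,k+1}}{\varrho_h^{k+1}-\varrho_h^k}+\frac{F^{k+1,k}-F^{k,k}}{\varrho_h^{k+1}-\varrho_h^k}\Big)\Big)A^n_{\boldsymbol v_h}\varrho_h^{k+\frac12}\\ &\quad-\frac12\Big(\frac{F^{k+1,k+1}-F^{k+1,k}}{\varsigma_h^{k+1}-\varsigma_h^k}+\frac{F^{k,k+1}-F^{k,k}}{\varsigma_h^{k+1}-\varsigma_h^k}\Big)A^n_{\boldsymbol v_h}\varsigma_h^{k+\frac12}-\beta_h^{k+\frac12}\wedge\star A^{n-1}_{\boldsymbol v_h}\beta_h^{k+\frac12}=0, \end{aligned} $$ $$ \frac{\varrho_h^{k+1}-\varrho_h^k}{\Delta t}+A^n_{\boldsymbol u_h^{k+\frac12}}\varrho_h^{k+\frac12}=0,\qquad \frac{\varsigma_h^{k+1}-\varsigma_h^k}{\Delta t}+A^n_{\boldsymbol u_h^{k+\frac12}}\varsigma_h^{k+\frac12}=0,\qquad \frac{\beta_h^{k+1}-\beta_h^k}{\Delta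 t}+A^{n-1}_{\boldsymbol u_h^{k+\frac12}}\beta_h^{k+\frac12}=0 . $$ The quotients are pointwise; where a denominator vanishes the quotient is understood as its limit (the corresponding partial derivative of $\rho e(\rho,s)$). *)

(* Defs.v *)
From HB Require Import structures.
From mathcomp Require Import all_boot all_order all_algebra.
From mathcomp Require Import all_classical all_reals all_analysis.

Set Implicit Arguments.
Unset Strict Implicit.
Unset Printing Implicit Defensive.

Import Order.TTheory GRing.Theory Num.Theory.
Import numFieldNormedType.Exports.

Local Open Scope classical_set_scope.
Local Open Scope ring_scope.

Definition rV_display : measure_display -> measure_display.
Proof. exact. Qed.

(* The sigma-algebra generated by the coordinates, i.e. the Borel
   sigma-algebra of R^n. *)
Section measurable_rV.
Context (R : realType) (n : nat).

Let coord (i : 'I_n) (x : 'rV[R]_n) : R := x ord0 i.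

Let rV_set0 : g_sigma_preimage coord set0.
Proof. exact: sigma_algebra0. Qed.

Let rV_setC A : g_sigma_preimage coord A -> g_sigma_preimage coord (~` A).
Proof. exact: sigma_algebraC. Qed.

Let rV_bigcup (F : (set 'rV[R]_n)^nat) :
  (forall i, g_sigma_preimage coord (F i)) ->
  g_sigma_preimage coord (\bigcup_i (F i)).
Proof. exact: sigma_algebra_bigcup. Qed.

HB.instance Definition _ :=
  @isMeasurable.Build (rV_display default_measure_display) 'rV[R]_n
    (g_sigma_preimage coord) rV_set0 rV_setC rV_bigcup.

End measurable_rV.

Lemma measurable_coord (R : realType) (n : nat) (i : 'I_n) :
  measurable_fun [set: 'rV[R]_n] (fun x => x ord0 i).
Proof.
move=> _ Y mY; rewrite setTI; apply: sub_sigma_algebra => /=.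
rewrite -bigcup_seq/=; exists i => /=; first by rewrite mem_index_enum.
by exists Y => //; rewrite setTI.
Qed.

Lemma measurable_fun_coordP d (T : measurableType d) (R : realType) (n : nat)
    (f : T -> 'rV[R]_n) :
  (forall i, measurable_fun [set: T] (fun x => f x ord0 i)) ->
  measurable_fun [set: T] f.
Proof.
move=> mf; apply: (measurability (\big[setU/set0]_(i < n)
  preimage_set_system setT (fun x : 'rV[R]_n => x ord0 i) measurable)) => //.
move=> _ [B + <-]; rewrite -bigcup_seq /= => -[i _ [A mA <-]].
by rewrite !setTI -[X in measurable X]setTI; exact: mf.
Qed.

Definition snoc_rV (R : realType) (n : nat) (p : 'rV[R]_n * R) : 'rV[R]_n.+1 :=
  \row_i oapp (p.1 ord0) p.2 (unlift ord_max i).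

Lemma measurable_snoc_rV (R : realType) (n : nat) :
  measurable_fun setT (@snoc_rV R n).
Proof.
apply: measurable_fun_coordP => i.
case: (unliftP ord_max i) => [j ->|->].
- rewrite (_ : (fun _ => _) = (fun x : 'rV[R]_n => x ord0 j) \o fst).
    by apply: measurableT_comp => //; exact: measurable_coord.
  by apply/funext => x /=; rewrite mxE liftK.
- rewrite (_ : (fun _ => _) = snd) //.
  by apply/funext => x /=; rewrite mxE unlift_none.
Qed.

Fixpoint leb (R : realType) (n : nat) : {measure set 'rV[R]_n -> \bar R} :=
  match n with
  | 0 => \d_(0 : 'rV[R]_0)
  | m.+1 => measure_function_pushforward__canonical__measure_function_Measure
              (leb R m \x lebesgue_measure)%E (@measurable_snoc_rV R m)
  end.

Lemma leb_prod (R : realType) (n : nat) (A : 'I_n -> set R) :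
  (forall i, measurable (A i)) ->
  leb R n [set x | forall i, A i (x ord0 i)] =
  (\prod_i lebesgue_measure (A i))%E.
Proof.
elim: n A => [|n IHn] A mA.
  rewrite big_ord0 /= /dirac indicE mem_set //=; by case.
rewrite big_ord_recr /= -IHn // /pushforward.
rewrite (_ : _ @^-1` _ = [set x : 'rV[R]_n |
    forall i, A (widen_ord (leqnSn n) i) (x ord0 i)] `*` A ord_max); last first.
  apply/seteqP; split => -[x y] /=.
    move=> h; split => [i|]; last by have := h ord_max; rewrite mxE unlift_none.
    have := h (lift ord_max i); rewrite mxE liftK /=.
    rewrite (_ : lift _ _ = widen_ord (leqnSn n) i) //.
    by apply/val_inj; rewrite /= /bump leqNgt ltn_ord.
  case=> h1 h2 i; rewrite mxE; case: (unliftP ord_max i) => [j ->|->] //=.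
  rewrite (_ : lift _ _ = widen_ord (leqnSn n) j) //.
  by apply/val_inj; rewrite /= /bump leqNgt ltn_ord.
rewrite product_measure1E //.
rewrite (_ : [set _ | _] = \bigcap_i ((fun x : 'rV[R]_n => x ord0 i) @^-1`
    A (widen_ord (leqnSn n) i))).
  apply: fin_bigcap_measurable => // i _.
  by rewrite -[X in measurable X]setTI; exact: measurable_coord.
by apply/seteqP; split => x /= h i; [move=> _; exact: h|exact: (h i I)].
exact: mA.
Qed.

Section exterior_algebra.
Context {R : realType} {n : nat}.

(* The alternating form \sum_S a_S e^S, where e^S = e^{i_1} /\ ... /\ e^{i_k}
   for S = {i_1 < ... < i_k}, is represented by its coefficients a_S. *)
Definition alt := {set 'I_n} -> R.

Definition top (a : alt) : R := a [set: 'I_n]%SET.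

(* Sign of the shuffle: e^S /\ e^T = shuffle S T e^(S :|: T) for disjoint S, T. *)
Definition shuffle (S T : {set 'I_n}) : R :=
  (-1) ^+ #|[pred p : 'I_n * 'I_n | [&& p.1 \in S, p.2 \in T & (p.2 < p.1)%N]]|.

Definition wedge (a b : alt) : alt :=
  fun S => \sum_(T : {set 'I_n} | T \subset S)
             shuffle T (S :\: T)%SET * a T * b (S :\: T)%SET.

(* Hodge star of the Euclidean metric and of the standard orientation. *)
Definition star (a : alt) : alt :=
  fun S => shuffle (~: S)%SET S * a (~: S)%SET.

Definition iprod (u : 'rV[R]_n) (a : alt) : alt :=
  fun S => \sum_(i | i \notin S)
             shuffle [set i]%SET S * u ord0 i * a (i |: S)%SET.

(* a(t_1, ..., t_k) for the homogeneous component of degree k of a. *)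
Definition alt_apply (a : alt) (t : seq 'rV[R]_n) : R :=
  foldl (fun b v => iprod v b) a t finset.set0.

Definition covector (u : 'rV[R]_n) : alt :=
  fun S => \sum_(i | S == [set i]%SET) u ord0 i.

Definition dot (u v : 'rV[R]_n) : R := \sum_i u ord0 i * v ord0 i.

End exterior_algebra.
Arguments alt : clear implicits.

Section smooth.
Context {R : realType} {n : nat}.

Definition partial (i : 'I_n) (f : 'rV[R]_n -> R) : 'rV[R]_n -> R :=
  'D_(delta_mx ord0 i) f.

Definition smooth_on (D : set 'rV[R]_n) (f : 'rV[R]_n -> R) :=
  forall (s : seq 'I_n) x, D x -> differentiable (foldr partial f s) x.

Definition test_function (D : set 'rV[R]_n) (f : 'rV[R]_n -> R) :=
  smooth_on setT f /\
  exists K, [/\ compact K, K `<=` D & forall x, ~ K x -> f x = 0].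

End smooth.

Section forms.
Context {R : realType} {n : nat}.
Notation Rn := 'rV[R]_n.

Definition form_field := Rn -> alt R n.

Definition locally_integrable_on (m : {measure set Rn -> \bar R})
    (D : set Rn) (f : Rn -> R) :=
  measurable_fun D f /\
  forall K, compact K -> m.-integrable (D `&` K) (EFin \o f).

(* Forms on Omega are taken up to equality almost everywhere. *)
Definition is_form (Omega : set Rn) (i : nat) (a : form_field) :=
  (forall x (S : {set 'I_n}), Omega x -> #|S| != i -> a x S = 0) /\
  (forall S, measurable_fun Omega (fun x => a x S)).

Definition test_form (D : set Rn) (i : nat) (phi : form_field) :=
  (forall x (S : {set 'I_n}), #|S| != i -> phi x S = 0) /\
  (forall S, test_function D (fun x => phi x S)).

Definition dform (a : form_field) : form_field :=
  fun x S => \sum_(i in S) shuffle [set i]%SET (S :\ i)%SET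
                           * partial i (fun y => a y (S :\ i)%SET) x.

(* b = d a for an i-form a on Omega, in the sense of distributions; local
   integrability is required up to the boundary, so that traces make sense. *)
Definition ext_deriv (Omega : set Rn) (i : nat) (a b : form_field) :=
  [/\ is_form Omega i a, is_form Omega i.+1 b,
      (forall S, locally_integrable_on (leb R n) Omega (fun x => a x S)),
      (forall S, locally_integrable_on (leb R n) Omega (fun x => b x S)) &
      forall j phi, (i + j).+1%N = n -> test_form Omega j phi ->
        \int[leb R n]_(x in Omega) top (wedge (b x) (phi x)) =
        (-1) ^+ i.+1 *
        \int[leb R n]_(x in Omega) top (wedge (a x) (dform phi x))].

Definition boundary (Omega : set Rn) : set Rn := closure Omega `\` Omega.

(* A domain for which Stokes' theorem holds with respect to a surface measure
   sigma on the boundary and a unit outward normal nu, i.e. in terms of the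
   vector field X, \int_Omega div X dx = \int_{\partial Omega} X . nu dsigma. *)
Record stokes_domain (Omega : set Rn) (sigma : {measure set Rn -> \bar R})
    (nu : Rn -> Rn) : Prop := StokesDomain {
  domain_open : open Omega ;
  domain_connected : connected Omega ;
  domain_nonempty : Omega !=set0 ;
  surface_boundary : sigma (~` boundary Omega) = 0%E ;
  surface_locally_finite : forall K, compact K -> (sigma K < +oo)%E ;
  normal_measurable : forall i, measurable_fun setT (fun x => nu x ord0 i) ;
  normal_unit : {ae sigma, forall x, dot (nu x) (nu x) = 1} ;
  stokes : forall X : Rn -> Rn,
    (forall i, test_function setT (fun x => X x ord0 i)) ->
    \int[leb R n]_(x in Omega) (\sum_i partial i (fun y => X y ord0 i) x) =
    \int[sigma]_x dot (X x) (nu x) }.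

(* tau is the field of boundary values of a, determined by Stokes' theorem
     \int_Omega d a /\ phi + (-1)^i a /\ d phi = \int_{\partial Omega} tau /\ phi
   for all test forms phi not necessarily vanishing on the boundary; the
   boundary integral of an (n-1)-form w is that of the density of
   nu^flat /\ w against the surface measure. *)
Definition boundary_values (Omega : set Rn)
    (sigma : {measure set Rn -> \bar R}) (nu : Rn -> Rn) (i : nat)
    (a tau : form_field) :=
  (forall S, locally_integrable_on sigma setT (fun x => tau x S)) /\
  exists b, ext_deriv Omega i a b /\
    forall j phi, (i + j).+1%N = n -> test_form setT j phi ->
      \int[leb R n]_(x in Omega)
        (top (wedge (b x) (phi x)) + (-1) ^+ i * top (wedge (a x) (dform phi x)))
      = \int[sigma]_x top (wedge (covector (nu x)) (wedge (tau x) (phi x))).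

Definition vanishing_trace (Omega : set Rn)
    (sigma : {measure set Rn -> \bar R}) (nu : Rn -> Rn)
    (i : nat) (a : form_field) :=
  exists tau, boundary_values Omega sigma nu i a tau /\
    {ae sigma, forall x, forall t : seq Rn, size t = i ->
       (forall v, v \in t -> dot v (nu x) = 0) -> alt_apply (tau x) t = 0}.

(* The boundary values w of u are again determined by Stokes' theorem; g is
   the divergence of u. *)
Definition tangent_field (Omega : set Rn)
    (sigma : {measure set Rn -> \bar R}) (nu : Rn -> Rn) (u : Rn -> Rn) :=
  [/\ (forall i, locally_integrable_on (leb R n) Omega (fun x => u x ord0 i)) &
  exists (g : Rn -> R) (w : Rn -> Rn),
  [/\ locally_integrable_on (leb R n) Omega g,
      (forall i, locally_integrable_on sigma setT (fun x => w x ord0 i)),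
      (forall phi, test_function setT phi ->
         \int[leb R n]_(x in Omega)
           (g x * phi x + \sum_i u x ord0 i * partial i phi x)
         = \int[sigma]_x (dot (w x) (nu x) * phi x)) &
      {ae sigma, forall x, dot (w x) (nu x) = 0}]].

End forms.
Arguments form_field : clear implicits.

(* The space V_h^i is the vectType [fsp i], embedded in the i-forms by
   [real i].  It is indexed by all i : nat; since there is no nonzero i-form
   for n < i, it is then zero by [real_inj].  As a form is determined by its
   values almost everywhere, [fspd] is the restriction of d to V_h^i. *)
Record form_spaces (R : realType) (n : nat) (Omega : set 'rV[R]_n) :=
  FormSpaces {
  fsp :> nat -> vectType R ;
  real : forall i, fsp i -> form_field R n ;
  fspd : forall i, fsp i -> fsp i.+1 ;
  real_linear : forall i c (a b : fsp i) x S,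
    real (c *: a + b) x S = c * real a x S + real b x S ;
  real_form : forall i (a : fsp i), is_form Omega i (real a) ;
  real_inj : forall i (a : fsp i),
    ae_eq (leb R n) Omega (real a) (fun _ _ => 0) -> a = 0 ;
  real_fspd : forall i (a : fsp i), ext_deriv Omega i (real a) (real (fspd a)) }.

Record field_space (R : realType) (n : nat) (Omega : set 'rV[R]_n)
    (sigma : {measure set 'rV[R]_n -> \bar R}) (nu : 'rV[R]_n -> 'rV[R]_n) :=
  FieldSpace {
  xsp :> vectType R ;
  field : xsp -> 'rV[R]_n -> 'rV[R]_n ;
  field_linear : forall c (u v : xsp) x,
    field (c *: u + v) x = c *: field u x + field v x ;
  field_inj : forall u : xsp,
    ae_eq (leb R n) Omega (field u) (fun _ => 0) -> u = 0 ;
  field_tangent : forall u : xsp, tangent_field Omega sigma nu (field u) }.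

Record projections (R : realType) (n : nat) (Omega : set 'rV[R]_n)
    (sigma : {measure set 'rV[R]_n -> \bar R}) (nu : 'rV[R]_n -> 'rV[R]_n)
    (V : form_spaces Omega) (X : field_space Omega sigma nu) := Projections {
  dom : nat -> set (form_field R n) ;
  proj : forall i, form_field R n -> V i ;
  dom_form : forall i a, dom i a -> is_form Omega i a ;
  dom_ae : forall i a b, dom i a -> is_form Omega i b ->
    ae_eq (leb R n) Omega a b -> dom i b /\ proj i a = proj i b ;
  dom_linear : forall i c a b, dom i a -> dom i b ->
    dom i (fun x S => c * a x S + b x S) ;
  proj_linear : forall i c a b, dom i a -> dom i b ->
    proj i (fun x S => c * a x S + b x S) = c *: proj i a + proj i b ;
  dom_real : forall i (a : V i), dom i (real a) ;
  proj_real : forall i (a : V i), proj i (real a) = a ;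
  dom_iprod : forall i (u : X) (a : V i.+1),
    dom i (fun x => iprod (field u x) (real a x)) ;
  proj_trace : forall i a, dom i a -> vanishing_trace Omega sigma nu i a ->
    vanishing_trace Omega sigma nu i (real (proj i a)) }.

Section lie_algebra.
Context {R : realType} {n : nat} {Omega : set 'rV[R]_n}.
Context {sigma : {measure set 'rV[R]_n -> \bar R}} {nu : 'rV[R]_n -> 'rV[R]_n}.
Context {V : form_spaces Omega} {X : field_space Omega sigma nu}.

Definition operators := forall i, V i -> V i.

Definition in_gh (A : operators) :=
  (forall i, linear (A i)) /\
  (forall i (a : V i), fspd (A i a) = A i.+1 (fspd a)).

Definition bracket (A B : operators) : operators :=
  fun i a => A i (B i a) - B i (A i a).

Definition advect (P : projections V X) (u : X) : operators :=
  fun i => match i return V i -> V i with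
  | 0 => fun a => proj P 0 (fun x => iprod (field u x) (real (fspd a) x))
  | j.+1 => fun a =>
      fspd (proj P j (fun x => iprod (field u x) (real a x)))
      + proj P j.+1 (fun x => iprod (field u x) (real (fspd a) x))
  end.

(* [hat] matters only on the Lie algebra, where it is linear. *)
Definition linear_left_inverse (P : projections V X) (hat : operators -> X) :=
  (forall c (A B : operators), in_gh A -> in_gh B ->
     hat (fun i a => c *: A i a + B i a) = c *: hat A + hat B) /\
  (forall u : X, hat (advect P u) = u).

End lie_algebra.
Arguments operators {R n Omega} V.

Record state (R : realType) (n : nat) (Omega : set 'rV[R]_n)
    (sigma : {measure set 'rV[R]_n -> \bar R}) (nu : 'rV[R]_n -> 'rV[R]_n)
    (V : form_spaces Omega) (X : field_space Omega sigma nu) := State {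
  vel : X ;
  rho : V n ;
  ent : V n ;
  mag : V n.-1 }.

Section scheme.
Context {R : realType} {n : nat} {Omega : set 'rV[R]_n}.
Context {sigma : {measure set 'rV[R]_n -> \bar R}} {nu : 'rV[R]_n -> 'rV[R]_n}.
Context {V : form_spaces Omega} {X : field_space Omega sigma nu}.
Variables (P : projections V X) (hat : operators V -> X).
Variables (U : set (R * R)) (e : R -> R -> R) (dt : R).

Definition mid (W : lmodType R) (a b : W) : W := 2^-1 *: (b + a).

Definition density i (a : V i) (x : 'rV[R]_n) : R := top (real a x).

Definition eden (r s : R) : R := r * e r s.

Definition diff_quotient (f : R -> R) (y1 y0 : R) : R :=
  if y1 == y0 then derive1 f y0 else (f y1 - f y0) / (y1 - y0).

Definition momentum_density (s0 s1 : state V X) (v : X) (x : 'rV[R]_n) : R :=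
  let r0 := density (rho s0) x in let r1 := density (rho s1) x in
  let t0 := density (ent s0) x in let t1 := density (ent s1) x in
  let u0 := field (vel s0) x in let u1 := field (vel s1) x in
  let um := mid (vel s0) (vel s1) in
  let rm := mid (rho s0) (rho s1) in
  let tm := mid (ent s0) (ent s1) in
  let bm := mid (mag s0) (mag s1) in
  dot (dt^-1 *: (r1 *: u1 - r0 *: u0)) (field v x)
  - density rm x *
    dot (field um x) (field (hat (bracket (advect P v) (advect P um))) x)
  + (dot u0 u1 / 2
     - 2^-1 * (diff_quotient (fun r => eden r t1) r1 r0
               + diff_quotient (fun r => eden r t0) r1 r0))
    * density (advect P v rm) x
  - 2^-1 * (diff_quotient (fun t => eden r1 t) t1 t0
            + diff_quotient (fun t => eden r0 t) t1 t0)
    * density (advect P v tm) x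
  - top (wedge (real bm x) (star (real (advect P v bm) x))).

(* Vanishing of the Lebesgue integral entails that the positive and the
   negative part of the integrand have the same, finite, integral. *)
Record scheme_step (s0 s1 : state V X) : Prop := SchemeStep {
  (* the arguments of e lie in its domain of definition *)
  step_domain : {ae leb R n, forall x, Omega x -> forall r t,
    r = density (rho s0) x \/ r = density (rho s1) x ->
    t = density (ent s0) x \/ t = density (ent s1) x -> U (r, t)} ;
  step_momentum : forall v : X,
    (\int[leb R n]_(x in Omega) (momentum_density s0 s1 v x)%:E = 0)%E ;
  step_rho : dt^-1 *: (rho s1 - rho s0)
    + advect P (mid (vel s0) (vel s1)) (mid (rho s0) (rho s1)) = 0 ;
  step_ent : dt^-1 *: (ent s1 - ent s0)
    + advect P (mid (vel s0) (vel s1)) (mid (ent s0) (ent s1)) = 0 ;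
  step_mag : dt^-1 *: (mag s1 - mag s0)
    + advect P (mid (vel s0) (vel s1)) (mid (mag s0) (mag s1)) = 0 }.

(* Extended real valued, so that no integrability has to be assumed. *)
Definition energy (s : state V X) : \bar R :=
  (\int[leb R n]_(x in Omega)
    (2^-1 * density (rho s) x * dot (field (vel s) x) (field (vel s) x)
     + eden (density (rho s) x) (density (ent s) x)
     + 2^-1 * top (wedge (real (mag s) x) (star (real (mag s) x))))%:E)%E.

End scheme.

(* Main.v *)
Require Import Defs.
From HB Require Import structures.
From mathcomp Require Import all_boot all_order all_algebra.
From mathcomp Require Import all_classical all_reals all_analysis.
From mathcomp Require Import measurable_realfun ring lra.
Import Order.TTheory GRing.Theory Num.Theory.
Import numFieldNormedType.Exports.
Set Implicit Arguments.
Unset Strict Implicit.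
Local Open Scope classical_set_scope.
Local Open Scope ring_scope.

(** Energy conservation comes from testing the momentum equation with the
midpoint velocity [v = u^{k+1/2}]. The bracket of [A_v] with itself vanishes,
and so does its image under the left inverse ([hat_bracket_self]). The
discrete advection equations turn [A_v] of the midpoint density, entropy and
magnetic field into [-1/dt] times the increments of these variables. Each
difference quotient of [F = rho e] then multiplies the increment that it is
divided by, so that the four quotients telescope to [F^{k+1,k+1} - F^{k,k}];
the term [u^k . u^{k+1} / 2] compensates the increment of [rho] in the kinetic
term, and the symmetry of [(a, b) |-> a /\ star b] ([top_wedge_star]) makes the
magnetic term a difference of squares. Thus the momentum integrand is,
pointwise, [1/dt] times the increment of the energy density
([momentum_density_mid]).

It remains to pass from a vanishing integral of a difference to equality of
two integrals. Neither energy is known to be finite, so additivity of the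
integral does not apply at once. The difference [h] of the two densities has
a zero integral, hence is integrable; adding [h] to a measurable function
changes neither the finiteness of the integrals of its positive and negative
parts, nor the integral when both are finite ([integralB_eq0]). Measurability
holds only off the null set [N] where the arguments of [e] may leave the open
set on which [e] is smooth, and [N] can be removed from the domain of
integration of any function, measurable or not ([integral_setD_null]). *)

(** * Integrals of almost equal functions *)

Lemma maxr0_perturb (R : realDomainType) (a b c : R) : `|a - b| <= c ->
  Num.max a 0 <= Num.max b 0 + c.
Proof. by rewrite ler_norml; case: (leP a 0); case: (leP b 0); lra. Qed.

Section integral_facts.
Local Open Scope ereal_scope.
Context d (T : measurableType d) (R : realType).
Context (mu : {measure set T -> \bar R}).
Import HBNNSimple.

Lemma ge0_le_integral_setD_null (D N : set T) (f : T -> \bar R) :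
  measurable N -> mu N = 0 -> (forall x, D x -> 0 <= f x) ->
  \int[mu]_(x in D) f x <= \int[mu]_(x in D `\` N) f x.
Proof.
move=> mN N0 f0; rewrite !ge0_integralE//; last by move=> x []/f0.
apply: ge_ereal_sup => _ /= [h hf <-].
apply: ereal_sup_ubound => /=.
have mNC : measurable (~` N) by exact: measurableC.
(* A simple function below f on D is cut off to 0 on N. *)
exists (proj_nnsfun h mNC) => [x|].
  rewrite /= /mindic /indic/=; have := hf x; rewrite !patchE.
  have [xN|xN] := boolP (x \in ~` N); last first.
    move=> _; rewrite mulr0; case: ifP => //; rewrite inE => -[_ xN'].
    by move: xN; rewrite notin_setE => /(_ xN').
  rewrite mulr1; case: ifPn => [xD|xD]; case: ifPn => //.
  - by rewrite notin_setE => /=; move: xN xD; rewrite !inE => xN xD /not_andP[].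
  - by rewrite inE => -[xD' _]; move: xD; rewrite notin_setE.
have -> : sintegral mu h = sintegral mu (h \_ setT).
  by apply: eq_sintegral => x; rewrite patch_setT.
rewrite -integral_nnsfun//.
rewrite (@ge0_negligible_integral _ _ _ mu setT N)//; last 2 first.
- exact/measurable_EFinP.
- by move=> x _; rewrite lee_fin.
rewrite setTD integral_nnsfun//.
apply: eq_sintegral => x /=.
by rewrite /mindic /indic patchE; case: ifP => _; rewrite ?mulr1 ?mulr0.
Qed.

Lemma ge0_integral_setD_null (D N : set T) (f : T -> \bar R) :
  measurable N -> mu N = 0 -> (forall x, D x -> 0 <= f x) ->
  \int[mu]_(x in D) f x = \int[mu]_(x in D `\` N) f x.
Proof.
move=> mN N0 f0; apply/eqP; rewrite eq_le ge0_le_integral_setD_null//=.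
rewrite !ge0_integralE//; last by move=> x []/f0.
apply: ge_ereal_sup => _ /= [h hf <-].
apply: ereal_sup_ubound => /=; exists h => // x.
apply: le_trans (hf x) _; rewrite !patchE.
case: ifPn => [|_]; first by rewrite inE => -[xD _]; rewrite mem_set.
by case: ifPn => //; rewrite inE => /f0.
Qed.

(** Here [f] need not be measurable: the integral of a nonnegative function is
the supremum of the integrals of the simple functions below it. *)
Lemma integral_setD_null (D N : set T) (f : T -> \bar R) :
  measurable N -> mu N = 0 ->
  \int[mu]_(x in D) f x = \int[mu]_(x in D `\` N) f x.
Proof.
move=> mN N0; rewrite integralE [RHS]integralE.
by congr (_ - _); apply: ge0_integral_setD_null.
Qed.

(** The convention [+oo - oo = -oo] makes the integral nonzero as soon as the
positive or the negative part has an infinite integral. *)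
Lemma integral_eq0_integrable (D : set T) (f : T -> \bar R) :
  measurable D -> measurable_fun D f ->
  \int[mu]_(x in D) f x = 0 -> mu.-integrable D f.
Proof.
move=> mD mf; rewrite integralE => I0; apply/integrableP; split => //.
have -> : (fun x => `|f x|) = (fun x => f^\+ x + f^\- x).
  exact: fune_abse f.
rewrite ge0_integralD//; last 2 first.
- exact: measurable_funepos.
- exact: measurable_funeneg.
have p0 : 0 <= \int[mu]_(x in D) f^\+ x by apply: integral_ge0.
have n0 : 0 <= \int[mu]_(x in D) f^\- x by apply: integral_ge0.
move: I0 p0 n0; case: (\int[mu]_(x in D) f^\+ x) => [a||];
  case: (\int[mu]_(x in D) f^\- x) => [b||] //=.
by rewrite ltry.
Qed.

Lemma integral_perturb_lty (D : set T) (f g h : T -> \bar R) :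
  measurable D -> measurable_fun D f -> measurable_fun D g ->
  mu.-integrable D h ->
  (forall x, D x -> 0 <= f x) -> (forall x, D x -> 0 <= g x) ->
  (forall x, D x -> f x <= g x + `|h x|) ->
  \int[mu]_(x in D) g x < +oo -> \int[mu]_(x in D) f x < +oo.
Proof.
move=> mD mf mg /integrableP[mh hoo] f0 g0 fgh goo.
apply: (@le_lt_trans _ _ (\int[mu]_(x in D) (g x + `|h x|))).
  apply: ge0_le_integral => //.
  by apply: emeasurable_funD => //; exact: measurableT_comp.
rewrite ge0_integralD//; last exact: measurableT_comp.
exact: lte_add_pinfty.
Qed.

(** Neither [f] nor [g] is assumed to be integrable. *)
Lemma integralB_eq0 (D : set T) (f g : T -> R) (c : R) :
  measurable D -> measurable_fun D f -> measurable_fun D g -> c != 0%R ->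
  \int[mu]_(x in D) (c * (g x - f x))%:E = 0 ->
  \int[mu]_(x in D) (g x)%:E = \int[mu]_(x in D) (f x)%:E.
Proof.
move=> mD mf mg c0 I0.
have mF : measurable_fun D (EFin \o f) by exact/measurable_EFinP.
have mG : measurable_fun D (EFin \o g) by exact/measurable_EFinP.
have ih : mu.-integrable D (EFin \o (g \- f)%R).
  have ich : mu.-integrable D (fun x => (c * (g x - f x))%:E).
    apply: integral_eq0_integrable => //; apply/measurable_EFinP.
    by apply: measurable_funM => //; exact: measurable_funB.
  have := integrableZl mD c^-1 ich; apply: eq_integrable => // x _ /=.
  by rewrite -EFinM mulKf.
have h0 : \int[mu]_(x in D) ((EFin \o (g \- f)%R) x) = 0.
  have : \int[mu]_(x in D) (c%:E * (EFin \o (g \- f)%R) x) = 0 by [].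
  rewrite integralZl// => /eqP; rewrite mule_eq0 eqe (negbTE c0) /=.
  by move/eqP.
have fgp : \int[mu]_(x in D) (EFin \o f)^\+ x < +oo <->
           \int[mu]_(x in D) (EFin \o g)^\+ x < +oo.
  split; apply: (@integral_perturb_lty D _ _ _ mD _ _ ih) => //;
    try exact: measurable_funepos; move=> x _; rewrite !funeposE/=.
    by rewrite -EFin_max -EFin_max -EFinD lee_fin maxr0_perturb.
  by rewrite -EFin_max -EFin_max -EFinD lee_fin maxr0_perturb// distrC.
have fgn : \int[mu]_(x in D) (EFin \o f)^\- x < +oo <->
           \int[mu]_(x in D) (EFin \o g)^\- x < +oo.
  split; apply: (@integral_perturb_lty D _ _ _ mD _ _ ih) => //;
    try exact: measurable_funeneg; move=> x _; rewrite !funenegE/=.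
    rewrite -EFin_max -EFin_max -EFinD lee_fin maxr0_perturb//.
    by rewrite opprK addrC distrC.
  rewrite -EFin_max -EFin_max -EFinD lee_fin maxr0_perturb//.
  by rewrite opprK addrC.
have [fi|nfi] := pselect (mu.-integrable D (EFin \o f)).
  have -> : (fun x => (g x)%:E) = (fun x => (EFin \o f) x + (EFin \o (g \- f)%R) x).
    by apply/funext => x /=; rewrite -EFinD addrC subrK.
  by rewrite integralD// h0 adde0.
(* The integral of f is now infinite or of the form +oo - oo, and its two parts
   are infinite exactly when those of g are. *)
rewrite integralE [RHS]integralE.
have infty (F : T -> \bar R) : (forall x, 0 <= F x) ->
    ~ (\int[mu]_(x in D) F x < +oo) -> \int[mu]_(x in D) F x = +oo.
  by move=> F0 /negP; rewrite -leNgt leye_eq => /eqP.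
have [fn|fn] := pselect (\int[mu]_(x in D) (EFin \o f)^\- x < +oo); last first.
  rewrite (infty _ _ fn)//; rewrite (infty (EFin \o g)^\-)//; last by move/fgn.
  by rewrite !addeNy.
have fp : ~ \int[mu]_(x in D) (EFin \o f)^\+ x < +oo.
  move=> fp; apply: nfi; apply/integrableP; split => //.
  have -> : (fun x => `|(EFin \o f) x|) =
            (fun x => (EFin \o f)^\+ x + (EFin \o f)^\- x).
    exact: fune_abse (EFin \o f).
  rewrite ge0_integralD//; last 2 first.
  - exact: measurable_funepos.
  - exact: measurable_funeneg.
  exact: lte_add_pinfty.
rewrite (infty _ _ fp)// (infty (EFin \o g)^\+)//; last by move/fgp.
have gn := proj1 fgn fn.
have ge0 F : (forall x, 0 <= F x) -> 0 <= \int[mu]_(x in D) F x.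
  by move=> F0; apply: integral_ge0.
rewrite !addye//.
- move: fn (ge0 _ (funeneg_ge0 (EFin \o f))).
  by case: (\int[mu]_(x in D) _).
- move: gn (ge0 _ (funeneg_ge0 (EFin \o g))).
  by case: (\int[mu]_(x in D) _).
Qed.

End integral_facts.

(** * Measurability on row vectors *)

(** An open set is the union of the boxes with rational centre and radius that
it contains. *)
Lemma open_measurable_rV (R : realType) (n : nat) (A : set 'rV[R]_n) :
  open A -> measurable A.
Proof.
move=> oA.
pose box (q : 'rV[rat]_n * rat) : set 'rV[R]_n :=
  [set x | forall i, ball (ratr (q.1 ord0 i) : R) (ratr q.2) (x ord0 i)].
have mbox q : measurable (box q).
  rewrite (_ : box q = \bigcap_i ((fun x : 'rV[R]_n => x ord0 i) @^-1`
      ball (ratr (q.1 ord0 i) : R) (ratr q.2))).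
    apply: fin_bigcap_measurable => // i _; rewrite -[X in measurable X]setTI.
    by apply: measurable_coord => //; exact: measurable_ball.
  by apply/seteqP; split => x /= h i; [move=> _; exact: h|exact: (h i I)].
suff -> : A = \bigcup_q (if asbool (box q `<=` A) then box q else set0).
  apply: countable_bigcupT_measurable => [|q]; last by case: ifP.
  exact: countableP.
apply/seteqP; split => [x Ax|x [q _]]; last first.
  by case: asboolP => // qA xq; exact: qA.
have /nbhs_ballP[r /= r0 rA] : nbhs x A by exact: open_nbhs_nbhs.
have [s /itvP sr] : exists s : rat, ratr s \in `]0, r / 2[.
  by apply: rat_in_itvoo; rewrite divr_gt0.
have s0 : 0 < ratr s :> R by rewrite sr.
have /choice[q qx] : forall i, exists q : rat, ball (x ord0 i) (ratr s) (ratr q).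
  move=> i; have /rat_in_itvoo[q /itvP qx] : x ord0 i - ratr s < x ord0 i + ratr s.
    by rewrite ltrBlDr -addrA ltrDl addr_gt0.
  by exists q; rewrite /ball/= ltr_distlC !qx.
exists (\row_i q i, s) => //.
have xq : box (\row_i q i, s) x by move=> i /=; rewrite mxE; exact/ball_sym.
rewrite (_ : asbool _ = true)//; apply/asboolP => y yq; apply: rA; split => //.
move=> i j; rewrite ord1 [r]splitr.
apply: (@ball_triangle _ _ (ratr (q j) : R)).
  by apply: le_ball (qx j); rewrite ltW// sr.
by have := yq j; rewrite /= mxE; apply: le_ball; rewrite ltW// sr.
Qed.

Lemma measurable_fun_continuous_rV (R : realType) (n : nat) (A : set 'rV[R]_n)
    (f : 'rV[R]_n -> R) : open A -> {in A, continuous f} -> measurable_fun A f.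
Proof.
move=> oA cf; apply: (measurability _ (RGenOpens.measurableE R)) => //.
move=> _ [_ [a [b ->]] <-]; apply: open_measurable_rV.
by apply: (continuous_inP f oA).1 => //; exact: itv_open.
Qed.

Lemma measurable_fun_rV d (T : measurableType d) (R : realType) (n : nat)
    (D : set T) (f : T -> 'rV[R]_n) :
  (forall i, measurable_fun D (fun x => f x ord0 i)) -> measurable_fun D f.
Proof.
move=> mf mD; move: (mD); apply: (measurability (\big[setU/set0]_(i < n)
  preimage_set_system setT (fun x : 'rV[R]_n => x ord0 i) measurable)) => //.
move=> _ [B + <-]; rewrite -bigcup_seq /= => -[i _ [A mA <-]].
by rewrite setTI; exact: mf.
Qed.

Lemma measurable_fun_smooth_comp (R : realType) (U : set (R * R))
    (e : R -> R -> R) d (T : measurableType d) (D : set T) (r t : T -> R) :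
  open U ->
  smooth_on [set z : 'rV[R]_2 | U (z ord0 ord0, z ord0 ord_max)]
          (fun z => e (z ord0 ord0) (z ord0 ord_max)) ->
  measurable_fun D r -> measurable_fun D t ->
  (forall x, D x -> U (r x, t x)) ->
  measurable_fun D (fun x => e (r x) (t x)).
Proof.
move=> oU se mr mt DU mD.
pose U' := [set z : 'rV[R]_2 | U (z ord0 ord0, z ord0 ord_max)].
have oU' : open U'.
  apply: (@open_comp _ _ (fun z : 'rV[R]_2 => (z ord0 ord0, z ord0 ord_max)) U).
    move=> z _.
    exact: (cvg_pair (@coord_continuous R 1 2 ord0 ord0 z)
                     (@coord_continuous R 1 2 ord0 ord_max z)).
  exact: oU.
have me : measurable_fun U' (fun z : 'rV[R]_2 => e (z ord0 ord0) (z ord0 ord_max)).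
  apply: measurable_fun_continuous_rV => // z; rewrite inE => Uz.
  exact/differentiable_continuous/(se [::]).
pose p x : 'rV[R]_2 := \row_i (if i == ord0 then r x else t x).
have mp : measurable_fun D p.
  apply: measurable_fun_rV => i.
  under eq_fun do rewrite mxE.
  by case: (i == ord0).
have -> : (fun x => e (r x) (t x)) =
    (fun z : 'rV[R]_2 => e (z ord0 ord0) (z ord0 ord_max)) \o p.
  by apply/funext => x /=; rewrite !mxE.
apply: (measurable_comp _ _ me mp) => //; first exact: open_measurable_rV.
by move=> _ [x Dx <-]; rewrite /U' /= !mxE /=; exact: DU.
Qed.

(** * Pointwise algebra *)

Section exterior.
Context {R : realType} {n : nat}.
Implicit Types (a b : alt R n) (u v w : 'rV[R]_n).

Lemma top_wedge_star a b : top (wedge a (star b)) = \sum_S a S * b S.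
Proof.
rewrite /top /wedge; apply: eq_big => [T|T _]; first by rewrite finset.subsetT.
rewrite finset.setTD /star finset.setCK mulrACA.
by rewrite /shuffle -expr2 sqrr_sign mul1r.
Qed.

Lemma dotC u v : dot u v = dot v u.
Proof. by apply: eq_bigr => i _; rewrite mulrC. Qed.

Lemma dotDl u v w : dot (u + v) w = dot u w + dot v w.
Proof. by rewrite -big_split; apply: eq_bigr => i _; rewrite mxE mulrDl. Qed.

Lemma dotZl c u w : dot (c *: u) w = c * dot u w.
Proof. by rewrite /dot mulr_sumr; apply: eq_bigr => i _; rewrite mxE mulrA. Qed.

Lemma dotNl u w : dot (- u) w = - dot u w.
Proof. by rewrite -scaleN1r dotZl mulN1r. Qed.

Lemma dotDr u v w : dot w (u + v) = dot w u + dot w v.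
Proof. by rewrite !(dotC w) dotDl. Qed.

Lemma dotZr c u w : dot w (c *: u) = c * dot w u.
Proof. by rewrite !(dotC w) dotZl. Qed.

Lemma dot0r w : dot w 0 = 0.
Proof. by rewrite -(scale0r 0) dotZr mul0r. Qed.

End exterior.

(** For [y1 = y0] both sides vanish, whatever the derivative is. *)
Lemma diff_quotientM (R : realType) (f : R -> R) (y1 y0 : R) :
  diff_quotient f y1 y0 * (y1 - y0) = f y1 - f y0.
Proof.
rewrite /diff_quotient; case: eqVneq => [->|y10]; first by rewrite !subrr mulr0.
by rewrite divfK// subr_eq0.
Qed.

Section linear_embeddings.
Context {R : realType} {n : nat} {Omega : set 'rV[R]_n}.
Context {sigma : {measure set 'rV[R]_n -> \bar R}} {nu : 'rV[R]_n -> 'rV[R]_n}.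
Context {V : form_spaces Omega} {X : field_space Omega sigma nu}.

Lemma real0 i x S : real (0 : V i) x S = 0.
Proof.
by have := real_linear (-1) (0 : V i) 0 x S; rewrite scaler0 addr0 mulN1r addNr.
Qed.

Lemma realZ i c (a : V i) x S : real (c *: a) x S = c * real a x S.
Proof. by rewrite -[c *: a]addr0 real_linear real0 addr0. Qed.

Lemma realD i (a b : V i) x S : real (a + b) x S = real a x S + real b x S.
Proof. by rewrite -[a in LHS]scale1r real_linear mul1r. Qed.

Lemma realB i (a b : V i) x S : real (a - b) x S = real a x S - real b x S.
Proof. by rewrite realD -scaleN1r realZ mulN1r. Qed.

Lemma field0 x : field (0 : X) x = 0.
Proof.
by have := field_linear (-1) (0 : X) 0 x; rewrite scaler0 addr0 scaleN1r addNr.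
Qed.

Lemma field_mid (u v : X) x : field (mid u v) x = 2^-1 *: (field v x + field u x).
Proof.
rewrite /mid -[2^-1 *: _]addr0 field_linear field0 addr0.
by rewrite -[v in LHS]scale1r field_linear scale1r.
Qed.

Lemma measurable_field (u : X) (i : 'I_n) :
  measurable_fun Omega (fun x => field u x ord0 i).
Proof. by have [/(_ i)[]] := field_tangent u. Qed.

Lemma measurable_real i (a : V i) S : measurable_fun Omega (fun x => real a x S).
Proof. by have [_] := real_form a. Qed.

End linear_embeddings.

(** * The energy balance *)

Section energy_conservation.
Context {R : realType} {n : nat} {Omega : set 'rV[R]_n}.
Context {sigma : {measure set 'rV[R]_n -> \bar R}} {nu : 'rV[R]_n -> 'rV[R]_n}.
Context {V : form_spaces Omega} {X : field_space Omega sigma nu}.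
Context (P : projections V X) (hat : operators V -> X).
Context (hhat : linear_left_inverse P hat).
Context (U : set (R * R)) (e : R -> R -> R) (dt : R).

Lemma hat_bracket_self (A : operators V) : hat (bracket A A) = 0.
Proof.
(* The identity lies in g_h, and the zero operator is - id + id; by
   linearity, hat sends the latter to 0. *)
have gid : in_gh (fun i (a : V i) => a) by split => // i c a b.
have := hhat.1 (-1) _ _ gid gid; rewrite scaleN1r addNr => <-; congr hat.
apply: functional_extensionality_dep => i; apply/funext => a.
by rewrite /bracket subrr scaleN1r addNr.
Qed.

(** The integrand of the energy. *)
Definition energy_density (s : state V X) (x : 'rV[R]_n) : R :=
  2^-1 * density (rho s) x * dot (field (vel s) x) (field (vel s) x)
  + eden e (density (rho s) x) (density (ent s) x)
  + 2^-1 * top (wedge (real (mag s) x) (star (real (mag s) x))).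

(** A discrete advection equation, solved for the advected form. *)
Lemma advect_step i (s0 s1 : state V X) (a0 a1 : V i) :
  dt^-1 *: (a1 - a0) + advect P (mid (vel s0) (vel s1)) (mid a0 a1) = 0 ->
  forall x S, real (advect P (mid (vel s0) (vel s1)) (mid a0 a1)) x S =
    - dt^-1 * (real a1 x S - real a0 x S).
Proof.
move=> /eqP; rewrite addrC addr_eq0 -scaleNr => /eqP -> x S.
by rewrite realZ realB.
Qed.

Lemma momentum_density_mid (s0 s1 : state V X) : scheme_step P hat U e dt s0 s1 ->
  forall x, momentum_density P hat e dt s0 s1 (mid (vel s0) (vel s1)) x =
    dt^-1 * (energy_density s1 x - energy_density s0 x).
Proof.
move=> [_ _ hr ht hb] x; rewrite /momentum_density hat_bracket_self field0.
rewrite dot0r mulr0 subr0 /energy_density.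
have advd (a0 a1 : V n) :
    dt^-1 *: (a1 - a0) + advect P (mid (vel s0) (vel s1)) (mid a0 a1) = 0 ->
    density (advect P (mid (vel s0) (vel s1)) (mid a0 a1)) x =
    - dt^-1 * (density a1 x - density a0 x).
  by move=> h; rewrite /density /top (advect_step h).
rewrite (advd _ _ hr) (advd _ _ ht) !top_wedge_star field_mid.
under eq_bigr => S _ do rewrite (advect_step hb) /mid realZ realD.
set u0 := field (vel s0) x; set u1 := field (vel s1) x.
set r0 := density (rho s0) x; set r1 := density (rho s1) x.
set t0 := density (ent s0) x; set t1 := density (ent s1) x.
have -> : \sum_S 2^-1 * (real (mag s1) x S + real (mag s0) x S) *
      (- dt^-1 * (real (mag s1) x S - real (mag s0) x S)) =
    - dt^-1 * (2^-1 * (\sum_S real (mag s1) x S * real (mag s1) x S)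
               - 2^-1 * (\sum_S real (mag s0) x S * real (mag s0) x S)).
  rewrite -mulrBr -sumrB !mulr_sumr; apply: eq_bigr => S _; ring.
rewrite !(dotZl, dotDl, dotNl, dotZr, dotDr) (dotC u1 u0).
have q1 := diff_quotientM (fun r => eden e r t1) r1 r0.
have q2 := diff_quotientM (fun r => eden e r t0) r1 r0.
have q3 := diff_quotientM (fun t => eden e r1 t) t1 t0.
have q4 := diff_quotientM (fun t => eden e r0 t) t1 t0.
move: (diff_quotient _ _ _) q1 (diff_quotient _ _ _) q2 (diff_quotient _ _ _) q3
  (diff_quotient _ _ _) q4 => d1 q1 d2 q2 d3 q3 d4 q4 /=.
set b0 := \sum_S real (mag s0) x S * _; set b1 := \sum_S real (mag s1) x S * _.
(* Each quotient is paired with its own increment. *)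
transitivity (dt^-1 * (2^-1 * (r1 * dot u1 u1 - r0 * dot u0 u0)
  + 2^-1 * (d1 * (r1 - r0) + d2 * (r1 - r0) + d3 * (t1 - t0) + d4 * (t1 - t0))
  + 2^-1 * (b1 - b0))).
  ring.
by rewrite q1 q2 q3 q4; move: dt^-1 => c; field.
Qed.

Lemma measurable_energy_density (D : set 'rV[R]_n) (s : state V X) : open U ->
  smooth_on [set z : 'rV[R]_2 | U (z ord0 ord0, z ord0 ord_max)]
    (fun z => e (z ord0 ord0) (z ord0 ord_max)) ->
  measurable Omega -> D `<=` Omega ->
  (forall x, D x -> U (density (rho s) x, density (ent s) x)) ->
  measurable_fun D (energy_density s).
Proof.
move=> oU se mO DO DU.
have mreal i (a : V i) S : measurable_fun D (fun x => real a x S).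
  exact: measurable_funS (measurable_real a S).
have mfield (u : X) i : measurable_fun D (fun x => field u x ord0 i).
  exact: measurable_funS (measurable_field u i).
apply: measurable_funD; first apply: measurable_funD.
- apply: measurable_funM; first by apply: measurable_funM => //; exact: mreal.
  by apply: measurable_sum => i; exact: measurable_funM.
- apply: measurable_funM; first exact: mreal.
  by apply: (measurable_fun_smooth_comp oU se) => //; exact: mreal.
- apply: measurable_funM => //.
  under eq_fun do rewrite top_wedge_star.
  by apply: measurable_sum => S; exact: measurable_funM.
Qed.

End energy_conservation.

Theorem proposition8 (R : realType) (n : nat) (hn : n = 2%N \/ n = 3%N)
  (Omega : set 'rV[R]_n) (sigma : {measure set 'rV[R]_n -> \bar R})
  (nu : 'rV[R]_n -> 'rV[R]_n) (hOmega : stokes_domain Omega sigma nu)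
  (V : form_spaces Omega) (X : field_space Omega sigma nu)
  (P : projections V X) (hat : operators V -> X)
  (hinj : injective (advect P)) (hhat : linear_left_inverse P hat)
  (U : set (R * R)) (hU : open U) (e : R -> R -> R)
  (he : smooth_on [set z : 'rV[R]_2 | U (z ord0 ord0, z ord0 ord_max)]
          (fun z => e (z ord0 ord0) (z ord0 ord_max)))
  (dt : R) (hdt : 0 < dt) (st : nat -> state V X) (k : nat) :
  scheme_step P hat U e dt (st k) (st k.+1) ->
  energy e (st k.+1) = energy e (st k).
Proof.
move=> hs; have [[N [mN N0 hN]] mom _ _ _] := hs.
have mO : measurable Omega by exact: open_measurable_rV (domain_open hOmega).
have DU x : (Omega `\` N) x -> forall r t,
    r = density (rho (st k)) x \/ r = density (rho (st k.+1)) x ->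
    t = density (ent (st k)) x \/ t = density (ent (st k.+1)) x -> U (r, t).
  by move=> [Ox Nx]; apply: contrapT => nU; apply: Nx; apply: hN => /(_ Ox).
rewrite /energy (integral_setD_null _ _ mN N0) [RHS](integral_setD_null _ _ mN N0).
apply: (@integralB_eq0 _ _ _ _ _ (energy_density e (st k))
  (energy_density e (st k.+1)) dt^-1).
- exact: measurableD.
- by apply: (measurable_energy_density hU he) => // x Dx; apply: (DU x Dx); left.
- by apply: (measurable_energy_density hU he) => // x Dx; apply: (DU x Dx); right.
- by rewrite invr_neq0// gt_eqF.
rewrite -integral_setD_null//.
rewrite -[RHS](mom (mid (vel (st k)) (vel (st k.+1)))).
by apply: eq_integral => x _; rewrite (momentum_density_mid hhat hs).
Qed.
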